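(* Let $N\ge3$ and consider the multi-rate system with $N$ queues in which the arrival processes $A_i(t)$, $i\in\{1,\ldots,N\}$, are independent and Bernoulli, i.i.d. over slots, with $\Pr[A_i(t)=1]=3/N$ and $\Pr[A_i(t)=0]=1-3/N$, and the channel state processes are i.i.d. with $\Pr[S_i(t)=5]=\Pr[S_i(t)=0]=1/2$ for all $i$. Let $Z(t)$ be the number of non-empty queues on slot $t$. For any scheduling policy for which $Z(t)$ has a well defined steady state distribution, we have in steady state $$\Pr[Z(t)\ge N/2]\ge\frac13,$$ and hence $\mathbb{E}\{Z(t)\}\ge N/6$. That is, the average number of non-empty queues is at least $N/6$, and hence the average number of packets in the system is at least $N/6$.
   Context: System: slotted time $t\in\{0,1,2,\ldots\}$. Each slot the scheduling policy selects at most one link for transmission; $\mu_i(t)=S_i(t)$ if link $i$ is selected on slot $t$ and $\mu_i(t)=0$ otherwise (so the maximum rate is $\mu_{i,max}=5$ packets/slot). Queue backlogs (non-negative integers, in packets) evolve as $Q_i(t+1)=\max[Q_i(t)-\mu_i(t),0]+A_i(t)$. Channel states are i.i.d. over slots and independent of arrivals. A scheduling policy is any non-anticipating rule (the current backlogs $Q_i(t)$ are independent of the current arrivals $A_i(t)$). A queue is non-empty on slot $t$ if $Q_i(t)>0$, so $Z(t)=|\{i:Q_i(t)>0\}|$. ''In steady state'' means at a time $t$ when $Z(t)$ has its steady state distribution, so that $Z(t)$ and $Z(t+1)$ have the same distribution. *)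

(* Defs.v *)
From HB Require Import structures.
From mathcomp Require Import all_boot all_order all_algebra.
From mathcomp Require Import all_classical all_reals all_analysis.

Set Implicit Arguments.
Unset Strict Implicit.
Unset Printing Implicit Defensive.

Import Order.TTheory GRing.Theory Num.Theory.

Local Open Scope classical_set_scope.
Local Open Scope ring_scope.

Section Independence.
Context {d d' : measure_display} {T : measurableType d} {rT : measurableType d'}.
Context {R : realType} (P : probability T R).

(* The product rule over the finite subfamilies (duplicate-free lists [J]) of a
   possibly infinite family. *)
Definition mutually_independent {I : eqType} (X : I -> T -> rT) : Prop :=
  forall (J : seq I) (B : I -> set rT), uniq J -> (forall i, measurable (B i)) ->
    P (\bigcap_(i in [set` J]) X i @^-1` B i) =
      (\prod_(i <- J) P (X i @^-1` B i))%E.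

Definition sigma_generated {I : Type} (X : I -> T -> rT) : set (set T) :=
  <<s \bigcup_i preimage_set_system setT (X i) measurable >>.

(* Independence of the two families jointly, i.e. of the vectors or processes
   that they form; nothing is required inside each family. *)
Definition independent_families {I K : Type}
    (X : I -> T -> rT) (Y : K -> T -> rT) : Prop :=
  forall E F : set T, sigma_generated X E -> sigma_generated Y F ->
    P (E `&` F) = (P E * P F)%E.

End Independence.

Section Queues.
Context {d : measure_display} {T : measurableType d} {N : nat}.
Implicit Types (Q S A : 'I_N -> nat -> T -> nat).

(* [sel t w] is the link selected on slot [t] in outcome [w], [None] if the
   system idles. *)
Definition transmission_rate S (sel : nat -> T -> option 'I_N)
    (i : 'I_N) (t : nat) (w : T) : nat :=
  if sel t w == Some i then S i t w else 0%N.

(* Subtraction on [nat] is truncated, so [q - m] is max[q - m, 0]. *)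
Definition queue_dynamics Q S A (sel : nat -> T -> option 'I_N) : Prop :=
  forall i t w,
    Q i t.+1 w = (Q i t w - transmission_rate S sel i t w + A i t w)%N.

Definition nonempty_queues Q (t : nat) (w : T) : nat :=
  #|[pred i : 'I_N | (0 < Q i t w)%N]|.

Definition total_backlog Q (t : nat) (w : T) : nat := (\sum_(i < N) Q i t w)%N.

Context {R : realType} (P : probability T R).

(* Non-anticipation is expressed by its effect on the backlogs. The rule may be
   randomized and use the whole past and the current channel states. *)
Definition non_anticipating Q A : Prop :=
  forall t, independent_families P (fun i => Q i t) (fun i => A i t).

(* Only stationarity from slot [t] to slot [t.+1] is required. *)
Definition in_steady_state (Z : nat -> T -> nat) (pi : probability nat R)
    (t : nat) : Prop :=
  pushforward P (Z t) =1 pi /\ pushforward P (Z t.+1) =1 pi.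

End Queues.

(* Main.v *)
Require Import Defs.
From HB Require Import structures.
From mathcomp Require Import all_boot all_order all_algebra.
From mathcomp Require Import all_classical all_reals all_analysis.
From mathcomp Require Import measurable_realfun lra.

Set Implicit Arguments.
Unset Strict Implicit.
Unset Printing Implicit Defensive.

Import Order.TTheory GRing.Theory Num.Theory.

Local Open Scope classical_set_scope.
Local Open Scope ring_scope.

(** The number [Z] of non-empty queues has drift zero in steady state, because
    [0 <= Z <= N].  In one slot at most one queue is served, so at most one
    queue empties; and every empty queue that receives a packet becomes
    non-empty ([leq_nonempty_step]).  The backlogs on slot [t] are independent
    of the arrivals on slot [t], so a given queue is empty and receives a packet
    with probability [3 / N] times the probability that it is empty
    ([non_anticipating_preimageI]); the expected number of queues that become
    non-empty is therefore [(3 / N) * (N - E Z)].  Zero drift forces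
    [(3 / N) * (N - E Z) <= 1], that is [E Z >= 2 N / 3].

    On the other hand [Z] is below [N / 2] off the event [Z >= N / 2], and at
    most [N] on it, so [E Z <= N / 2 + (N / 2) * Pr (Z >= N / 2)]
    ([reverse_markov_half]).  Together these give [Pr (Z >= N / 2) >= 1 / 3].
    Each non-empty queue holds at least one packet, whence the bound on the
    backlog. *)

Section NatExpectation.
Context {d : measure_display} {T : measurableType d} {R : realType}.
Variable P : probability T R.
Implicit Types X Y : T -> nat.

Lemma measurable_natr X :
  measurable_fun setT X -> measurable_fun setT (fun w => (X w)%:R : R).
Proof.
move=> mX; have mR : measurable_fun setT (fun n : nat => n%:R : R) by [].
exact: (measurableT_comp mR mX).
Qed.

Lemma measurable_sum_nat {I : Type} (s : seq I) (X : I -> T -> nat) :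
  (forall i, measurable_fun setT (X i)) ->
  measurable_fun setT (fun w => (\sum_(i <- s) X i w)%N).
Proof.
move=> mX; elim: s => [|i s IH].
  by under eq_fun do rewrite big_nil; exact: measurable_cst.
by under eq_fun do rewrite big_cons; exact: measurable_fun_addn.
Qed.

Lemma measurable_nat_of_bool (b : T -> bool) :
  measurable [set w | b w] -> measurable_fun setT (fun w => nat_of_bool (b w)).
Proof.
move=> mb; have mB : measurable_fun setT nat_of_bool by [].
apply: (measurableT_comp mB).
by apply: (measurable_fun_bool true); rewrite setTI.
Qed.

Lemma expectation_natr_le X Y :
  measurable_fun setT X -> measurable_fun setT Y ->
  (forall w, X w <= Y w)%N ->
  ('E_P[fun w => (X w)%:R] <= 'E_P[fun w => (Y w)%:R])%E.
Proof.
move=> mX mY XY; apply: expectation_le => //; try exact: measurable_natr.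
by apply: aeW => w; rewrite ler_nat.
Qed.

Lemma expectation_natrD X Y :
  measurable_fun setT X -> measurable_fun setT Y ->
  ('E_P[fun w => (X w + Y w)%N%:R] =
    'E_P[fun w => (X w)%:R] + 'E_P[fun w => (Y w)%:R])%E.
Proof.
move=> mX mY; rewrite unlock -ge0_integralD//.
- by apply: eq_integral => w _; rewrite natrD EFinD.
- by apply/measurable_EFinP; exact: measurable_natr.
- by apply/measurable_EFinP; exact: measurable_natr.
Qed.

Lemma expectation_natr_bool (b : T -> bool) :
  measurable [set w | b w] ->
  'E_P[fun w => (nat_of_bool (b w))%:R]%E = P [set w | b w].
Proof.
move=> mb; rewrite -expectation_indic//; congr expectation; apply/funext => w.
by rewrite indicE; congr (nat_of_bool _)%:R; apply/idP/idP; rewrite inE.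
Qed.

Lemma expectation_natr_count {I : Type} (s : seq I) (b : I -> T -> bool) :
  (forall i, measurable [set w | b i w]) ->
  ('E_P[fun w => (\sum_(i <- s) b i w)%N%:R] =
    \sum_(i <- s) P [set w | b i w])%E.
Proof.
move=> mb; elim: s => [|i s IH].
  under [X in expectation _ X]eq_fun do rewrite big_nil.
  by rewrite big_nil (expectation_cst P 0).
under [X in expectation _ X]eq_fun do rewrite big_cons.
rewrite big_cons -IH -expectation_natr_bool// expectation_natrD//.
  exact: measurable_nat_of_bool.
by apply: measurable_sum_nat => j; exact: measurable_nat_of_bool.
Qed.

Lemma eq_expectation_natr X Y :
  measurable_fun setT X -> measurable_fun setT Y ->
  pushforward P X =1 pushforward P Y ->
  ('E_P[fun w => (X w)%:R] = 'E_P[fun w => (Y w)%:R])%E.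
Proof.
move=> mX mY XY.
have E Z : measurable_fun setT Z ->
    ('E_P[fun w => (Z w)%:R] = \int[pushforward P Z]_n (n%:R : R)%:E)%E.
  by move=> mZ; rewrite (ge0_integral_pushforward mZ)// ?unlock//.
by rewrite !E//; congr (integral _ _ _); exact/funext.
Qed.

(** Applied to a count of queues, this turns a lower bound on its mean into one
    on the probability that the count reaches [n / 2].  Off the event
    [n <= 2 X] the variable is at most [n / 2], on it at most [n]. *)
Lemma reverse_markov_half X (n : nat) :
  measurable_fun setT X -> (forall w, X w <= n)%N ->
  ('E_P[fun w => (X w)%:R] + 'E_P[fun w => (X w)%:R] <=
     n%:R%:E + n%:R%:E * P [set w | (n%:R / 2 <= (X w)%:R :> R)%R])%E.
Proof.
move=> mX leXn; set B := [set w | _].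
have BE : B = [set w | (n <= X w + X w)%N].
  apply/funext => w; rewrite /B /=; congr is_true.
  by rewrite ler_pdivrMr// mulr_natr mulr2n -natrD ler_nat.
have mB : measurable [set w | (n <= X w + X w)%N].
  rewrite (_ : [set _ | _] = X @^-1` [set k | (n <= k + k)%N])//.
  by rewrite -[X in measurable X]setTI; exact: mX.
(* [n * P B] as the mean of [n] copies of the indicator of [B], so that both
   sides are means of natural numbers, comparable outcome by outcome. *)
have -> : (n%:R%:E * P B =
    'E_P[fun w => (\sum_(i < n) (n <= X w + X w)%N)%N%:R])%E.
  rewrite (expectation_natr_count _ (b := fun=> _))// -BE.
  rewrite -(fineK (fin_num_measure P B _)) ?BE// sumEFin.
  by rewrite sumr_const card_ord -[in RHS]mulr_natl EFinM.
rewrite -(expectation_cst P n%:R) /cst -!expectation_natrD//; last first.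
  by apply: measurable_sum_nat => _; exact: measurable_nat_of_bool.
apply: expectation_natr_le => [||w].
- exact: measurable_fun_addn.
- apply: measurable_fun_addn => //.
  by apply: measurable_sum_nat => _; exact: measurable_nat_of_bool.
rewrite sum_nat_const card_ord.
case: (leqP n (X w + X w)) => /= h; rewrite ?muln1 ?muln0 ?addn0.
  exact: leq_add.
exact: ltnW.
Qed.

End NatExpectation.

Section Slot.
Context {d : measure_display} {T : measurableType d} {N : nat}.
Implicit Types (Q S A : 'I_N -> nat -> T -> nat).

Lemma nonempty_queuesE Q t w :
  nonempty_queues Q t w = (\sum_(i < N) (0 < Q i t w))%N.
Proof. by rewrite /nonempty_queues -sum1_card big_mkcond. Qed.

Lemma nonempty_queues_le Q t w : (nonempty_queues Q t w <= N)%N.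
Proof. by rewrite -[leqRHS]card_ord; exact: max_card. Qed.

Lemma nonempty_queues_le_backlog Q t w :
  (nonempty_queues Q t w <= total_backlog Q t w)%N.
Proof. by rewrite nonempty_queuesE; apply: leq_sum => i _; case: (Q i t w). Qed.

Lemma measurable_nonempty_queues Q t :
  (forall i, measurable_fun setT (Q i t)) ->
  measurable_fun setT (nonempty_queues Q t).
Proof.
move=> mQ; rewrite (funext (nonempty_queuesE Q t)).
apply: measurable_sum_nat => i.
apply: measurable_nat_of_bool; rewrite -[X in measurable X]setTI.
exact: (mQ i measurableT [set n | (0 < n)%N]).
Qed.

(** The inequality holds queue by queue once [1] is replaced by the indicator
    that the queue is selected: a queue that is not selected cannot empty, and
    a selected one accounts for a single unit. *)
Lemma leq_nonempty_step Q S A sel t w :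
  queue_dynamics Q S A sel ->
  (nonempty_queues Q t w + \sum_(i < N) ((Q i t w == 0) && (A i t w == 1)) <=
     nonempty_queues Q t.+1 w + 1)%N.
Proof.
move=> hQ.
have served : (\sum_(i < N) (sel t w == Some i) <= 1)%N.
  case: (sel t w) => [k|]; last by rewrite big1.
  rewrite (bigD1 k)//= eqxx big1// => i; rewrite eq_sym => /negPf ik.
  by apply/eqP; rewrite eqb0; apply/eqP => -[/eqP]; rewrite ik.
apply: leq_trans (leq_add (leqnn _) served).
rewrite !nonempty_queuesE -!big_split; apply: leq_sum => i _ /=.
rewrite hQ /transmission_rate.
move: (Q i t w) (S i t w) (A i t w) => q s a; case: (sel t w == Some i) => /=.
  case: q => [|q] /=; last by rewrite addn0 leq_addl.
  by rewrite add0n addn1; apply: leqW; rewrite sub0n; case: a => [|[|]].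
by rewrite subn0 addn0; case: q => [|q]; case: a => [|[|a]].
Qed.

Context {R : realType} (P : probability T R).

Lemma sigma_generated_preimage {I : Type} (X : I -> T -> nat) i (B : set nat) :
  sigma_generated X (X i @^-1` B).
Proof.
by apply: sub_sigma_algebra; exists i => //; exists B => //; rewrite setTI.
Qed.

Lemma non_anticipating_preimageI Q A i t (B C : set nat) :
  non_anticipating P Q A ->
  P (Q i t @^-1` B `&` A i t @^-1` C) =
    (P (Q i t @^-1` B) * P (A i t @^-1` C))%E.
Proof.
move=> hna; apply: (hna t).
  exact: (sigma_generated_preimage (X := Q^~ t)).
exact: (sigma_generated_preimage (X := A^~ t)).
Qed.

End Slot.

Theorem lemma11 (R : realType) (d : measure_display) (T : measurableType d)
    (P : probability T R) (N : nat) (hN : (3 <= N)%N)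
    (A S Q : 'I_N -> nat -> {RV P >-> nat})
    (sel : nat -> T -> option 'I_N)
    (hA_indep : mutually_independent P
       (fun it : 'I_N * nat => A it.1 it.2 : T -> nat))
    (hA1 : forall i t, P [set w | A i t w = 1%N] = (3 / N%:R)%:E)
    (hA0 : forall i t, P [set w | A i t w = 0%N] = (1 - 3 / N%:R)%:E)
    (hS_indep : mutually_independent P
       (fun it : 'I_N * nat => S it.1 it.2 : T -> nat))
    (hS5 : forall i t, P [set w | S i t w = 5%N] = (1 / 2)%:E)
    (hS0 : forall i t, P [set w | S i t w = 0%N] = (1 / 2)%:E)
    (hSA : independent_families P
       (fun it : 'I_N * nat => S it.1 it.2 : T -> nat)
       (fun it : 'I_N * nat => A it.1 it.2 : T -> nat))
    (hsel : forall t i, measurable [set w | sel t w = Some i])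
    (hQ : queue_dynamics Q S A sel)
    (hna : non_anticipating P Q A)
    (pi : probability nat R) (t : nat)
    (hss : in_steady_state P (nonempty_queues Q) pi t) :
  [/\ ((1 / 3)%:E <=
         P [set w | (N%:R / 2 <= (nonempty_queues Q t w)%:R :> R)%R])%E,
      ((N%:R / 6)%:E <= 'E_P[fun w => (nonempty_queues Q t w)%:R])%E &
      ((N%:R / 6)%:E <= 'E_P[fun w => (total_backlog Q t w)%:R])%E].
Proof.
have N0 : 0 < N%:R :> R by rewrite ltr0n; apply: leq_trans hN.
pose Z := nonempty_queues (fun i t => Q i t : T -> nat).
have mQ s i : measurable_fun setT (Q i s : T -> nat) by [].
have mZ s : measurable_fun setT (Z s) by exact: measurable_nonempty_queues.
pose E i := (Q i t : T -> nat) @^-1` [set 0%N].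
have mpre (X : {RV P >-> nat}) (B : set nat) : measurable (X @^-1` B).
  by rewrite -[Y in measurable Y]setTI; exact: (measurable_funP X).
have mE i : measurable (E i) by exact: mpre.
pose p i := fine (P (E i)).
have PE i : P (E i) = (p i)%:E by rewrite fineK// fin_num_measure.
pose z : R := N%:R - \sum_(i < N) p i.
(* [z] is the mean of [Z], and [N - z] the expected number of empty queues. *)
have EZ : 'E_P[fun w => (Z t w)%:R]%E = z%:E.
  under [X in expectation _ X]eq_fun do rewrite /Z nonempty_queuesE.
  rewrite (expectation_natr_count P _ (b := fun i w => (0 < Q i t w)%N)).
    transitivity (\sum_(i < N) (1 - p i)%:E)%E.
      apply: eq_bigr => i _.
      rewrite (_ : [set w | _] = ~` E i).
        by rewrite (probability_setC P (mE i)) PE.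
      by apply/seteqP; split=> w; rewrite /E /= lt0n => /eqP.
    by rewrite sumEFin sumrB sumr_const card_ord.
  by move=> i; exact: (mpre (Q i t) [set n | (0 < n)%N]).
pose b i w := (Q i t w == 0%N) && (A i t w == 1%N).
have bE i : [set w | b i w] = E i `&` (A i t : T -> nat) @^-1` [set 1%N].
  apply/seteqP; split=> w; rewrite /b /E /=; last by move=> [-> ->].
  by move=> /andP[/eqP -> /eqP ->].
have mb i : measurable [set w | b i w] by rewrite bE; exact: measurableI.
have Eb : 'E_P[fun w => (\sum_(i < N) b i w)%N%:R]%E =
    (3 / N%:R * (N%:R - z))%:E.
  rewrite expectation_natr_count// /z opprB addrCA subrr addr0 mulrC mulr_suml.
  rewrite -sumEFin; apply: eq_bigr => i _.
  by rewrite bE (non_anticipating_preimageI i t [set 0%N] [set 1%N] hna) PE hA1.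
have EZS : 'E_P[fun w => (Z t.+1 w)%:R]%E = z%:E.
  by rewrite -EZ; apply: eq_expectation_natr => // B; rewrite hss.1 hss.2.
(* Means of the one-slot inequality: the two means of [Z] cancel, and one
   departure bounds the expected number of queues that become non-empty. *)
have zge : 2 * N%:R / 3 <= z.
  have mbs : measurable_fun setT (fun w => (\sum_(i < N) b i w)%N).
    by apply: measurable_sum_nat => i; exact: measurable_nat_of_bool.
  have : ('E_P[fun w => (Z t w + \sum_(i < N) b i w)%N%:R] <=
          'E_P[fun w => (Z t.+1 w + 1)%N%:R])%E.
    apply: expectation_natr_le => [||w]; try exact: measurable_fun_addn.
    exact: leq_nonempty_step hQ.
  rewrite !expectation_natrD// EZ Eb EZS (expectation_cst P 1) lee_fin lerD2l.
  by rewrite mulrAC ler_pdivrMr// mul1r; lra.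
have zN6 : N%:R / 6 <= z by lra.
split.
- have := reverse_markov_half P (mZ t) (nonempty_queues_le _ t).
  set B := [set w | _]; have mB : measurable B.
    have -> : B = Z t @^-1` [set k | N%:R / 2 <= k%:R :> R] by [].
    by rewrite -[X in measurable X]setTI; exact: mZ.
  rewrite [X in (X + _)%E]EZ [X in (_ + X)%E]EZ.
  rewrite -[P _](fineK (fin_num_measure P B mB)) !lee_fin.
  set q := fine _ => hq.
  rewrite -(ler_pM2l N0); lra.
- by rewrite [leRHS]EZ lee_fin.
- apply: (@le_trans _ _ ('E_P[fun w => (Z t w)%:R])%E).
    by rewrite EZ lee_fin.
  apply: expectation_natr_le => // [|w].
    exact: measurable_sum_nat.
  exact: nonempty_queues_le_backlog.
Qed.
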